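(* Let $n\ge 1$ and suppose that $\alpha\in S_n$ has precisely $m\ge 1$ nontrivial cycles, each cycle having the same length $d$ (so $d>1$). If $\alpha$ has at least one fixed point, then $\alpha\in\mathrm{Aut}(n)$ if and only if $n\le 2md$. If $\alpha$ has no fixed points, then $\alpha\in\mathrm{Aut}(n)$ if and only if $d$ is odd or $m$ is even.
   Context: A Latin square of order $n$ is an $n\times n$ array $L=L(i,j)$ with rows, columns and symbols indexed by $[n]=\{1,\dots,n\}$ such that the symbols in every row and in every column are distinct. $S_n$ is the symmetric group on $[n]$. A permutation $\alpha\in S_n$ is an automorphism of $L$ if $\alpha(L(i,j))=L(\alpha(i),\alpha(j))$ for all $i,j\in[n]$. $\mathrm{Aut}(n)$ denotes the set of all $\alpha\in S_n$ that are an automorphism of at least one Latin square of order $n$. A cycle of a permutation is nontrivial if its length is greater than one; fixed points are the cycles of length $1$. *)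

(* Defs.v *)
From mathcomp Require Import all_boot all_fingroup all_algebra.

Set Implicit Arguments.
Unset Strict Implicit.
Unset Printing Implicit Defensive.

(* Rows, columns and symbols are indexed by 'I_n = {0, ..., n-1} instead of
   {1, ..., n}. *)
Definition latin_square (n : nat) (L : 'M['I_n]_n) : bool :=
  [forall i, injectiveb (fun j => L i j)] &&
  [forall j, injectiveb (fun i => L i j)].

Definition latin_automorphism (n : nat) (L : 'M['I_n]_n) (a : 'S_n) : bool :=
  [forall i, forall j, a (L i j) == L (a i) (a j)].

Definition AutLS (n : nat) : {set 'S_n} :=
  [set a : 'S_n | [exists L : 'M['I_n]_n,
                     latin_square L && latin_automorphism L a]].

(* A cycle is represented by its underlying set of points, so its length is the
   cardinality of that set. *)
Definition nontrivial_cycles (n : nat) (a : 'S_n) : {set {set 'I_n}} :=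
  [set C in porbits a | 1 < #|C|].

(* Main.v *)
Require Import Defs.
From mathcomp Require Import all_boot all_fingroup all_algebra.
From mathcomp Require Import zify.

(* Up to conjugation, a is the shift (i, x) |-> (i, x + 1) on m copies of Z_d
   together with the identity on f points.
   If f > 0, a non-fixed row maps fixed columns injectively to non-fixed symbols,
   so f <= md. Conversely, view the shift as translation by m in Z_(md) and prolong:
   from bijections r, c of Z_(md) with r(g) = c(g) + g for g <> 0, fill the cells
   (x, x + g) for f values of g, among them g = 0, with a fixed symbol, and all
   other cells with x + r(g).
   If f = 0 with d even and m odd, summing Z_d-coordinates over orbits of cells
   shows that an odd multiple of d/2 vanishes in Z_d; otherwise there are explicit
   squares based on (x, y) |-> 2x - y. *)

Set Implicit Arguments.
Unset Strict Implicit.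
Unset Printing Implicit Defensive.

Import GRing.Theory.

(** * Latin squares over arbitrary carriers, and coordinates along cycles *)

Definition admits_latin (T : Type) (s : T -> T) : Prop :=
  exists L : T -> T -> T,
    [/\ forall x, injective (L x), forall y, injective (L^~ y)
      & forall x y, s (L x y) = L (s x) (s y)].

Definition sum_map (A B C D : Type) (f : A -> C) (g : B -> D) (u : A + B) : C + D :=
  match u with inl x => inl (f x) | inr y => inr (g y) end.

(** With [d.+2] as cycle length, ['I_d.+2] is the ring of integers modulo that length; [d] has the
    same parity as the length. *)
Definition cycle_shift (I : Type) (d : nat) (u : I * 'I_d.+2) : I * 'I_d.+2 :=
  (u.1, u.2 + 1)%R.

Lemma admits_latin_conj (T U : Type) (s : T -> T) (s' : U -> U) (e : T -> U) :
  bijective e -> (forall x, e (s x) = s' (e x)) ->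
  admits_latin s <-> admits_latin s'.
Proof.
have conj A B (p : A -> A) (q : B -> B) (g : A -> B) h :
    cancel g h -> cancel h g -> (forall x, g (p x) = q (g x)) ->
    admits_latin p -> admits_latin q.
  move=> gK hK gp [L [Lr Lc Le]]; exists (fun x y => g (L (h x) (h y))); split.
  - by move=> x y z /(can_inj gK)/Lr/(can_inj hK).
  - by move=> x y z /(can_inj gK)/Lc/(can_inj hK).
  - by move=> x y; rewrite -gp Le; congr (g (L _ _)); apply: (can_inj gK);
      rewrite gp !hK.
case=> h eK hK es; split; first exact: (conj _ _ _ _ e h).
by apply: (conj _ _ _ _ h e) => // x; apply: (can_inj eK); rewrite es !hK.
Qed.

Lemma AutLSP (n : nat) (a : 'S_n) : a \in AutLS n <-> admits_latin a.
Proof.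
rewrite inE; split.
  case/existsP=> L /andP[/andP[/forallP Lr /forallP Lc] /forallP La].
  exists (fun i j => L i j); split=> x.
  - exact/injectiveP.
  - exact/injectiveP.
  - by move=> y; apply/eqP/(forallP (La x)).
case=> L [Lr Lc La]; apply/existsP; exists (\matrix_(i, j) L i j)%R.
apply/andP; split; first (apply/andP; split).
- by apply/forallP=> i; apply/injectiveP=> x y; rewrite !mxE => /Lr.
- by apply/forallP=> i; apply/injectiveP=> x y; rewrite !mxE => /Lc.
- by apply/forallP=> i; apply/forallP=> j; rewrite !mxE La.
Qed.

Lemma cycle_coordinates (n d : nat) (a : 'S_n) :
  (forall C, C \in nontrivial_cycles a -> #|C| = d.+2) ->
  exists e : 'I_#|nontrivial_cycles a| * 'I_d.+2 + 'I_#|[pred x | a x == x]| -> 'I_n,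
    bijective e /\ forall u, e (sum_map (@cycle_shift _ _) id u) = a (e u).
Proof.
move=> hlen; set NT := nontrivial_cycles a in hlen *.
have [r rP] : exists r : 'I_#|NT| -> 'I_n, forall i, porbit a (r i) = enum_val i.
  apply: (fin_all_exists (U := fun _ => 'I_n)
            (P := fun i x => porbit a x = enum_val i)) => i.
  have := enum_valP i; rewrite inE => /andP[/imsetP[x _ ->] _].
  by exists x.
have rc i : #|porbit a (r i)| = d.+2 by rewrite rP hlen ?enum_valP.
have rK i : iter d.+2 a (r i) = r i by rewrite -(rc i) iter_porbit.
have rmod i k : iter (k %% d.+2) a (r i) = iter k a (r i).
  rewrite {2}(divn_eq k d.+2) addnC iterD; congr iter.
  by elim: (k %/ _) => // q IHq; rewrite mulSn addnC iterD rK.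
have mem i k : iter k a (r i) \in porbit a (r i) by rewrite -permX mem_porbit.
(* [r i] is a base point of the [i]-th nontrivial cycle, and [x] counts the applications of [a] to
   it. *)
pose e (u : 'I_#|NT| * 'I_d.+2 + 'I_#|[pred x | a x == x]|) :=
  match u with inl (i, x) => iter x a (r i) | inr k => enum_val k end.
(* A fixed point on the cycle would make its orbit a singleton. *)
have big i x : a (iter x a (r i)) != iter x a (r i).
  apply/eqP=> fx; have := rc i.
  have /eqP -> : porbit a (r i) == porbit a (iter x a (r i)).
    by rewrite eq_porbit_mem porbit_sym mem.
  suff -> : porbit a (iter x a (r i)) = [set iter x a (r i)] by rewrite cards1.
  apply/setP=> z; rewrite inE; apply/porbitP/eqP=> [[k ->]|->].
    by rewrite permX; elim: k => //= k ->.
  by exists 0; rewrite expg0 perm1.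
exists e; split.
  have e_inj : injective e.
    move=> [[i x]|k] [[j y]|l] /=.
    - move=> exy; have eij : i = j.
        apply: enum_val_inj; rewrite -!rP; apply/eqP.
        rewrite eq_porbit_mem.
        have := mem i x; rewrite exy => h; have := mem j y.
        rewrite -!eq_porbit_mem in h *.
        by move=> h'; rewrite -(eqP h) (eqP h').
      rewrite -eij in exy *; do 2 f_equal; apply: val_inj => /=.
      have := uniq_traject_porbit a (r i); rewrite rc.
      move/(nth_uniq (r i)) => /(_ x y).
      rewrite size_traject !ltn_ord => /(_ isT isT).
      by rewrite !nth_traject ?ltn_ord // exy eqxx => /esym/eqP.
    - move=> exy; have := enum_valP l; rewrite inE -exy.
      by rewrite (negPf (big i x)).
    - move=> exy; have := enum_valP k; rewrite inE exy.
      by rewrite (negPf (big j y)).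
    - by move/enum_val_inj ->.
  apply: inj_card_bij => //.
  rewrite -(card_codom e_inj); apply: subset_leq_card.
  apply/subsetP=> z _; apply/codomP.
  have [fz|fz] := boolP (a z == z).
    by exists (inr (enum_rank_in (fz : z \in [pred x | a x == x]) z));
       rewrite /= enum_rankK_in.
  have zNT : porbit a z \in NT.
    rewrite inE imset_f //=.
    suff: #|[set z; a z]| <= #|porbit a z| by rewrite cards2 eq_sym fz.
    by apply/subset_leq_card/subsetP=> y /set2P[]->;
      rewrite ?porbit_id // -[a z]/((a ^+ 1)%g z) mem_porbit.
  pose i := enum_rank_in zNT (porbit a z).
  have : z \in porbit a (r i) by rewrite rP enum_rankK_in // porbit_id.
  case/porbitP=> k ->; exists (inl (i, inord (k %% d.+2))).
  by rewrite /= inordK ?ltn_pmod // rmod permX.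
move=> [[i x]|k] /=; last by apply/esym/eqP; have := enum_valP k; rewrite inE.
by rewrite rmod -iterS -[in LHS]rmod modnDmr addn1 rmod.
Qed.

(** * Permutations with fixed points *)

Lemma fixed_points_le (U F : finType) (s : U -> U) (u : U) :
  s u != u -> admits_latin (sum_map s (@id F)) -> #|F| <= #|U|.
Proof.
move=> su [L [Lr Lc Le]].
have inlP k : exists v, L (inl u) (inr k) == inl v.
  case E: (L (inl u) (inr k)) => [v|l]; first by exists v.
  (* A fixed symbol here would occur in column [inr k] in both rows [u] and [s u]. *)
  have := Le (inl u) (inr k); rewrite E /= -E => /Lc [] /esym/eqP.
  by rewrite (negPf su).
have [h hP] := fin_all_exists inlP.
apply: (leq_card h) => k l hkl.
have : L (inl u) (inr k) = L (inl u) (inr l) by rewrite (eqP (hP k)) (eqP (hP l)) hkl.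
by move/Lr => [].
Qed.

(** Translation preserves each diagonal [y - x = g]. Diagonal [phi k] is filled with the new symbol
    [k], and its freed values [x + r (phi k)] and [y + c (phi k)] go to the new column and the new
    row [k]. On the other diagonals [x + r g = y + c g], so [r] controls the rows and [c] the
    columns. *)
Lemma prolongation (G : zmodType) (F : Type) (phi : F -> G) (psi : G -> option F)
    (M : F -> F -> F) (r c : G -> G) (t : G) :
  pcancel phi psi -> ocancel psi phi ->
  (forall x, injective (M x)) -> (forall y, injective (M^~ y)) ->
  injective r -> injective c ->
  (forall g, psi g = None -> r g = c g + g)%R ->
  admits_latin (sum_map (fun x => x + t)%R (@id F)).
Proof.
move=> phiK psiK Mr Mc rI cI rc.
have psiS g k : psi g = Some k -> g = phi k.
  by move=> E; have := psiK g; rewrite E /= => ->.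
pose L (u v : G + F) : G + F :=
  match u, v with
  | inl x, inl y => if psi (y - x)%R is Some k then inr k else inl (x + r (y - x))%R
  | inl x, inr k => inl (x + r (phi k))%R
  | inr k, inl y => inl (y + c (phi k))%R
  | inr k, inr l => inr (M k l)
  end.
have Lc x y : psi (y - x)%R = None -> (x + r (y - x) = y + c (y - x))%R.
  by move/rc ->; rewrite addrCA subrKC addrC.
have phiN g k : psi g = None -> g <> phi k by move=> E gk; rewrite gk phiK in E.
exists L; split.
- move=> [x|k] [y|l] [y'|l'] /=.
  + case E: (psi _) => [k|]; case E': (psi _) => [k'|] //.
      by move=> [kk]; rewrite kk in E; congr inl; apply: (@addIr _ (- x)%R);
        rewrite (psiS _ _ E) (psiS _ _ E').
    by move=> [/addrI/rI/addIr ->].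
  + by case E: (psi _) => // -[/addrI/rI/(phiN _ _ E)].
  + by case E: (psi _) => // -[/addrI/rI/esym/(phiN _ _ E)].
  + by move=> [/addrI/rI/(pcan_inj phiK) ->].
  + by move=> [/addIr ->].
  + by [].
  + by [].
  + by move=> [/Mr ->].
- move=> [y|k] [x|l] [x'|l'] /=.
  + case E: (psi _) => [k|]; case E': (psi _) => [k'|] //.
      by move=> [kk]; rewrite kk in E; congr inl; apply: oppr_inj;
        apply: (@addrI _ y); rewrite (psiS _ _ E) (psiS _ _ E').
    by rewrite !Lc // => -[/addrI/cI/addrI/oppr_inj ->].
  + by case E: (psi _) => //; rewrite Lc // => -[/addrI/cI/(phiN _ _ E)].
  + by case E: (psi _) => //; rewrite Lc // => -[/addrI/cI/esym/(phiN _ _ E)].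
  + by move=> [/addrI/cI/(pcan_inj phiK) ->].
  + by move=> [/addIr ->].
  + by [].
  + by [].
  + by move=> [/Mc ->].
- move=> [x|k] [y|l] //=; [|by rewrite addrAC..].
  by rewrite opprD addrACA subrr addr0; case: (psi _) => //=; rewrite addrAC.
Qed.

Lemma double_inj (N : nat) : odd N.+1 -> injective (fun x : 'I_N.+1 => x + x)%R.
Proof.
move=> Nodd x y /(congr1 val) /= E.
have dbl (z : 'I_N.+1) : (z + z) %% N.+1 = if z + z < N.+1 then z + z else z + z - N.+1.
  have zlt := ltn_ord z; case: ltnP => [/modn_small //|zN].
  by rewrite -{1}(subnK zN) modnDr modn_small //; lia.
apply: val_inj => /=; have := ltn_ord x; have := ltn_ord y; move: E.
by rewrite !dbl; do 2 case: ifP; lia.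
Qed.

(* For even order [r] and [c] cannot satisfy the identity everywhere, since the
   sum of all elements of [Z_N] is then nonzero. *)
Lemma near_complete_mapping (N : nat) :
  exists r c : 'I_N.+1 -> 'I_N.+1,
    [/\ injective r, injective c & forall g, g != 0%R -> (r g = c g + g)%R].
Proof.
have [Nodd|Neven] := boolP (odd N.+1).
  by exists (fun g => g + g)%R, id; split=> //; apply: double_inj.
pose r (g : nat) := if g < N.+1./2 then g.*2 else g.*2.+1 - N.+1.
pose c (g : nat) := if g < N.+1./2 then g else if g == N then N.+1./2 else g.+1.
have rN (g : 'I_N.+1) : r g < N.+1 by have := ltn_ord g; rewrite /r; case: ifP; lia.
have cN (g : 'I_N.+1) : c g < N.+1 by have := ltn_ord g; rewrite /c; do 2?case: ifP; lia.
pose r' g := Ordinal (rN g); pose c' g := Ordinal (cN g).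
have rI : injective r'.
  move=> u v /(congr1 val) /= E; apply: val_inj; move: E.
  by have := ltn_ord u; have := ltn_ord v; rewrite /r /=; do 2 case: ifP; lia.
have cI : injective c'.
  move=> u v /(congr1 val) /= E; apply: val_inj; move: E.
  by have := ltn_ord u; have := ltn_ord v; rewrite /c /=; do 4?case: ifP; lia.
(* [r' g = c' g + g] except at [g = N]; translating moves the exception to [0]. *)
exists (fun g => r' (g + ord_max))%R, (fun g => c' (g + ord_max) + ord_max)%R; split.
- by move=> x y /rI/addIr.
- by move=> x y /addIr/cI/addIr.
move=> g g0; rewrite -addrA [(ord_max + g)%R]addrC.
have : (g + ord_max)%R != ord_max.
  by apply: contraNneq g0 => /(canRL (addrK _)) ->; rewrite subrr.
move: (g + _)%R => u uN; apply: val_inj => /=.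
have : u != N :> nat by apply: contraNneq uN => uN; apply/eqP/val_inj.
have ult := ltn_ord u; rewrite /r /c; case: ltnP => uh h3.
  by rewrite addnn modn_small //; lia.
rewrite (negPf h3); have -> : u.+1 + u = u.*2.+1 - N.+1 + N.+1 by lia.
by rewrite modnDr modn_small //; lia.
Qed.

(** The orbits of translation by [m] are the residue classes modulo [m]: [i + m * x] has residue
    [i], and adding [m] advances [x], wrapping around because [m * d.+2] is zero in the group. *)
Lemma cycle_shift_cyclic (m d N : nat) : m * d.+2 = N.+1 ->
  exists e : 'I_m * 'I_d.+2 -> 'I_N.+1,
    bijective e /\ forall u, (e (cycle_shift u) = e u + inZp m)%R.
Proof.
move=> mdN; exists (fun u : 'I_m * 'I_d.+2 => inZp (u.1 + m * u.2) : 'I_N.+1).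
have m0 : 0 < m by case: m mdN.
have lt (i : 'I_m) (x : 'I_d.+2) : i + m * x < N.+1.
  by have := ltn_ord i; have := ltn_ord x; rewrite -mdN; nia.
split.
  apply: inj_card_bij; last by rewrite card_prod !card_ord mdN.
  move=> [i x] [j y] /(congr1 val) /=; rewrite !modn_small // => ixjy.
  have ij : i = j.
    apply: val_inj; move/(congr1 (modn^~ m)): ixjy.
    by rewrite /= ![m * _]mulnC ![_ + _ * m]addnC !modnMDl !modn_small.
  congr pair => //; apply/val_inj/eqP.
  by move/eqP: ixjy; rewrite ij eqn_add2l eqn_pmul2l.
move=> [i x]; apply: val_inj => /=; rewrite modnDm [1 %% _]modn_small //.
rewrite -addnA -[in RHS]mulnSr -[in RHS]addn1; have [xd|xd] := ltnP x d.+1.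
  by rewrite [(_ + 1) %% _]modn_small // addn1 ltnS.
have -> : x + 1 = d.+2 by have := ltn_ord x; lia.
by rewrite modnn muln0 addn0 mdN modnDr.
Qed.

Lemma admits_latin_fixed_points (m d f : nat) : 0 < f <= m * d.+2 ->
  admits_latin (sum_map (@cycle_shift 'I_m d) (@id 'I_f)).
Proof.
case/andP; case: f => // f _ fN.
have [N mdN] : exists N, m * d.+2 = N.+1 by exists (m * d.+2).-1; lia.
have [e [[e' eK eK'] es]] := cycle_shift_cyclic mdN.
apply/(@admits_latin_conj _ _ _ (sum_map (fun x : 'I_N.+1 => x + inZp m)%R id)
         (sum_map e (@id 'I_f.+1))).
- by exists (sum_map e' id) => -[x|k] //=; rewrite ?eK ?eK'.
- by move=> [x|k] //=; rewrite es.
have [r [c [rI cI rc]]] := near_complete_mapping N.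
rewrite mdN in fN.
(* The prolonged diagonals form an initial segment, hence contain 0, the only [g] where
   [r g = c g + g] may fail. *)
apply: (@prolongation _ _ (widen_ord fN) (fun g => insub (val g))
          (fun x y => x + y)%R r c) => //.
- by move=> k; rewrite /= valK.
- by move=> g; case: insubP => //= k _ kg; apply: val_inj.
- exact: addrI.
- exact: addIr.
by move=> g gN; apply: rc; apply: contra_eqN gN => /eqP ->; rewrite insubT.
Qed.

(** * Permutations without fixed points *)

Lemma admits_latin_odd (m d : nat) : odd d -> admits_latin (@cycle_shift 'I_m d).
Proof.
move=> dodd; case: m => [|m]; first by exists (fun u _ => u); split=> -[[]].
have dbl : injective (fun x : 'I_d.+2 => x + x)%R by apply: double_inj; rewrite /= negbK.
(* The coefficients of [2x - y] sum to 1, so it commutes with the shift; odd order makes doubling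
   injective in the columns. *)
exists (fun u v => (u.1 + v.1, u.2 + u.2 - v.2)%R); split.
- by move=> [i x] [j y] [j' y'] /= /pair_equal_spec[/addrI -> /addrI/oppr_inj ->].
- by move=> [j y] [i x] [i' x'] /= /pair_equal_spec[/addIr -> /addIr/dbl ->].
by move=> [i x] [j y]; congr pair; rewrite /= addrACA opprD [RHS]addrACA addrK.
Qed.

(** In even order, doubling has only even values and identifies [z] with [z + N.+1./2]. The added
    bit is recovered as the parity of the image, and the second component separates the two
    halves. *)
Lemma double_half_inj (N : nat) : odd N ->
  injective (fun p : 'I_N.+1 * bool =>
               ((p.1 + p.1 + if p.2 then inZp 1 else 0)%R, N.+1./2 <= p.1)).
Proof.
move=> Nodd [u b] [v c] /= /pair_equal_spec[/(congr1 val) /= E uv].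
have N0 : 0 < N by case: N Nodd {u v E uv}.
have val_if (e : bool) : val (if e then inZp 1 else 0 : 'I_N.+1)%R = e.
  by case: e => //=; rewrite modn_small.
have dbl (z : 'I_N.+1) (e : bool) :
    ((z + z) %% N.+1 + val (if e then inZp 1 else 0 : 'I_N.+1)%R) %% N.+1
      = if uphalf N <= z then z.*2 + e - N.+1 else z.*2 + e.
  have zlt := ltn_ord z; rewrite val_if modnDml addnn; case: ifP => zN.
    have e1 := leq_b1 e.
    have -> : z.*2 + e = (z.*2 + e - N.+1) + N.+1 by lia.
    by rewrite modnDr addnK modn_small //; lia.
  by have e1 := leq_b1 e; rewrite modn_small //; lia.
move: E; rewrite !dbl uv => E.
have bc : b = c.
  by move: E uv; do ?case: ifP; case: b; case: c => //; lia.
congr pair => //; apply: val_inj => /=; move: E uv; rewrite bc.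
by do ?case: ifP; case: c {bc}; lia.
Qed.

(* The case [m = 2] is given by [(x, p), (y, q) |-> (2x - y - p, q + [y - x >= d/2])];
   the general one is its product with a cyclic square of order [m/2]. *)
Lemma admits_latin_even (m d : nat) : ~~ odd d -> ~~ odd m ->
  admits_latin (@cycle_shift 'I_m d).
Proof.
move=> deven meven; case: m meven => [|m meven].
  by exists (fun u _ => u); split=> -[[]].
have [k mk] : exists k, m.+1 = #|{: 'I_k.+1 * bool}|.
  by exists m./2; rewrite card_prod card_ord card_bool; lia.
rewrite mk.
pose e (u : 'I_k.+1 * bool * 'I_d.+2) := (enum_rank u.1, u.2).
apply/(admits_latin_conj (s := @cycle_shift _ d) (e := e)) => //.
  by exists (fun u => (enum_val u.1, u.2)) => -[i x]; rewrite /e /= ?enum_rankK ?enum_valK.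
pose half (b : bool) : 'I_d.+2 := if b then inZp 1 else 0%R.
pose upper (z : 'I_d.+2) := d.+2./2 <= z.
(* With [g = y - x], the position [2x - y - p] is written [y - (2g + p)]: the shift fixes [g], and
   in a fixed column [double_half_inj] recovers [(g, p)]. *)
pose L (u v : 'I_k.+1 * bool * 'I_d.+2) :=
  (((u.1.1 + v.1.1)%R, v.1.2 (+) upper (v.2 - u.2)%R),
   (v.2 - (v.2 - u.2 + (v.2 - u.2) + half u.1.2))%R).
have dinj : injective (fun p => (p.1 + p.1 + half p.2, upper p.1))%R :=
  @double_half_inj d.+1 deven.
exists L; split.
- move=> [[i p] x] [[j q] y] [[j' q'] y']; rewrite /L /= => /pair_equal_spec[/pair_equal_spec[/addrI -> qq] yy].
  have yy' : y = y'.
    move: yy; rewrite !opprD !opprK !addrA !subrr !add0r.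
    by move=> /addIr/addIr/addrI/oppr_inj.
  by move: qq; rewrite yy' => /addIb ->.
- move=> [[j q] y] [[i p] x] [[i' p'] x']; rewrite /L /= => /pair_equal_spec[/pair_equal_spec[/addIr -> /addbI qq] /addrI/oppr_inj yy].
  have := @dinj (y - x, p)%R (y - x', p')%R.
  by rewrite /= yy qq => /(_ erefl) /pair_equal_spec[/addrI/oppr_inj -> ->].
move=> [[i p] x] [[j q] y]; rewrite /cycle_shift /L /=.
have -> : (y + 1 - (x + 1) = y - x)%R by rewrite opprD addrACA subrr addr0.
by rewrite [(y + 1 - _)%R]addrAC.
Qed.

(* With [sigma] the sum of all elements of [Z_d], summing the [Z_d]-coordinate
   of [L u v] minus that of [v] over one representative [(u, v)] of each orbit of
   cells gives [0] (take [u] at position [0] in its cycle and sum along rows) and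
   also [m ^ 2 * sigma] (take [v] at position [0] and sum along columns). *)
Lemma odd_cycles_odd_length (m d : nat) : ~~ odd d ->
  admits_latin (@cycle_shift 'I_m d) -> ~~ odd m.
Proof.
move=> deven [L [Lr Lc Le]]; apply/negP=> modd.
have iterE k u : iter k (@cycle_shift _ _) u = (u.1, u.2 + k%:R)%R :> 'I_m * 'I_d.+2.
  elim: k => [|k IHk] /=; first by rewrite addr0 -surjective_pairing.
  by rewrite IHk /cycle_shift /= -addrA -natr1.
have iterL k u v : iter k (@cycle_shift _ _) (L u v)
    = L (iter k (@cycle_shift _ _) u) (iter k (@cycle_shift _ _) v).
  by elim: k => //= k ->; rewrite Le.
(* Shifting row [(i, - y)] and column [(j, 0)] [y] times gives row [(i, 0)] and column [(j, y)]. *)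
have Lshift i j (y : 'I_d.+2) : ((L (i, 0) (j, y)).2 = (L (i, - y) (j, 0)).2 + y)%R.
  have := iterL y (i, - y)%R (j, 0)%R.
  by rewrite !iterE /= natr_Zp addNr add0r => <-.
pose sigma := (\sum_(y : 'I_d.+2) y)%R.
pose S := (\sum_(u : 'I_m * 'I_d.+2) u.2)%R.
have rowS u : (\sum_v (L u v).2)%R = S by rewrite /S [RHS](reindex_inj (Lr u)).
have colS v : (\sum_u (L u v).2)%R = S by rewrite /S [RHS](reindex_inj (Lc v)).
have sigma0 : (sigma *+ (m * m) = 0)%R.
  have rows : (\sum_(i < m) \sum_v (L (i, 0) v).2 = S *+ m)%R.
    by under eq_bigr do rewrite rowS; rewrite sumr_const card_ord.
  have cols : (\sum_(j < m) \sum_u (L u (j, 0)).2 = S *+ m)%R.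
    by under eq_bigr do rewrite colS; rewrite sumr_const card_ord.
  apply: (@addrI _ (S *+ m)%R); rewrite addr0 -[RHS]rows -cols.
  transitivity (\sum_(i < m) \sum_(j < m)
                  \sum_(y : 'I_d.+2) ((L (i, - y) (j, 0)).2 + y))%R; last first.
    apply: eq_bigr => i _; rewrite pair_bigA; apply: eq_bigr => -[j y] _.
    by rewrite Lshift.
  under [RHS]eq_bigr do under eq_bigr do rewrite big_split /=.
  under [RHS]eq_bigr do rewrite big_split /= sumr_const card_ord.
  rewrite big_split /= sumr_const card_ord -mulrnA [in RHS]exchange_big /=; congr (_ + _)%R.
  apply: eq_bigr => j _.
  rewrite [LHS](eq_bigr (fun u => (L (u.1, u.2) (j, 0)).2)%R); last by case.
  rewrite -(pair_bigA _ (fun i y => (L (i, y) (j, 0)).2)%R) /=.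
  by apply: eq_bigr => i _; rewrite [LHS](reindex_inj oppr_inj).
(* Pairing [y] with [- y] kills [2 * sigma], so the odd multiple [m * m] of [sigma] is [sigma]
   itself. *)
have sigma2 : (sigma *+ 2 = 0)%R.
  apply/eqP; rewrite mulr2n {2}/sigma (reindex_inj oppr_inj) /= sumrN.
  by rewrite subrr.
have : sigma = 0%R.
  rewrite -sigma0 -[m * m]odd_double_half oddM modd /= -mul2n mulrnDr mulrnA.
  by rewrite sigma2 mul0rn addr0.
have -> : (sigma = ('C(d.+2, 2))%:R)%R.
  rewrite -bin2_sum big_mkord natr_sum; apply: eq_bigr => y _.
  by rewrite natr_Zp.
rewrite Zp_nat => /(congr1 val) /= /eqP.
rewrite -/(_ %| _) bin2.
(* Since [d.+1] is coprime to [d.+2], the even number [d.+2] would have to divide its own half. *)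
have -> : (d.+2 * d.+2.-1)./2 = d.+2./2 * d.+1 by rewrite /= ; nia.
rewrite Gauss_dvdl ?coprimeSn // => /dvdn_leq; lia.
Qed.

Theorem theorem5p2 (n m d : nat) (a : 'S_n)
  (hn : 1 <= n) (hm : 1 <= m)
  (hcard : #|nontrivial_cycles a| = m)
  (hlen : forall C : {set 'I_n}, C \in nontrivial_cycles a -> #|C| = d) :
  ((exists i : 'I_n, a i = i) ->
     (a \in AutLS n <-> n <= 2 * m * d)) /\
  (~ (exists i : 'I_n, a i = i) ->
     (a \in AutLS n <-> (odd d \/ ~~ odd m))).
Proof.
(* As [m] is positive, some nontrivial cycle exists; its size forces [d > 1], so [d] can be replaced
   by [d.+2]. *)
have [C CNT] : exists C, C \in nontrivial_cycles a by apply/card_gt0P; rewrite hcard.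
have := CNT; rewrite inE => /andP[_]; rewrite (hlen _ CNT) => d_gt1.
case: d d_gt1 hlen => [|[|d]] // _ hlen.
have [e [eb es]] := cycle_coordinates hlen.
rewrite hcard in e eb es; set f := #|_| in e eb es.
have nE : n = m * d.+2 + f.
  by have := bij_eq_card eb; rewrite card_sum card_prod !card_ord.
have autP := iff_trans (AutLSP a) (iff_sym (admits_latin_conj eb es)).
have shift_neq (u : 'I_m * 'I_d.+2) : cycle_shift u != u.
  by apply/eqP=> /(congr1 snd) /eqP; rewrite -subr_eq0 addrAC subrr add0r oner_eq0.
split=> fixa.
  have f_gt0 : 0 < f by case: fixa => i ai; apply/card_gt0P; exists i; apply/eqP.
  have -> : (n <= 2 * m * d.+2) = (f <= m * d.+2) by rewrite nE; lia.
  apply: (iff_trans autP); split=> [|fmd].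
    move/(fixed_points_le (shift_neq (Ordinal hm, ord0))).
    by rewrite card_prod !card_ord.
  by apply: admits_latin_fixed_points; rewrite f_gt0.
have f0 : f = 0.
  by apply: eq_card0 => i; rewrite inE; apply/eqP=> ai; apply: fixa; exists i.
(* Without fixed points the right summand is empty, so the normal form is the bare shift. *)
have inl_bij : bijective (@inl ('I_m * 'I_d.+2) 'I_f).
  apply: inj_card_bij => [x y [] //|]; by rewrite card_sum !card_ord f0 addn0.
apply: (iff_trans autP).
apply: (iff_trans (iff_sym (admits_latin_conj inl_bij (s := @cycle_shift _ _) _))) => //.
rewrite /= negbK; split=> [adm|].
  by have [|deven] := boolP (odd d); [left|right; exact: odd_cycles_odd_length adm].
have [dodd _|deven [//|]] := boolP (odd d); first exact: admits_latin_odd.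
exact: admits_latin_even.
Qed.
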